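(* Let $\mathbb{A}$ and the groups $G_{a,b}=\langle C,D,Q,S,V\rangle$ of $8\times 8$ matrices be as defined in the context. (1) For each $a\in\mathbb{A}$ and each odd $b\ge 3$ with $\gcd(a,b)=1$, $G_{a,b}$ is a subgroup of $\mathrm{O}(8)$ of order $16m$, where $m=a\cdot b$. (2) Let $a\in\mathbb{A}$, let $b\ge 3$ be odd with $\gcd(a,b)=1$, and let $b'>b$ be odd and relatively prime to $a$. If $b$ divides $b'$, then $G_{a,b}$ is a subgroup of $G_{a,b'}$. (3) For each $a\in\mathbb{A}$ and each odd $b\ge 3$ with $\gcd(a,b)=1$, the natural $8$-dimensional representation of $G_{a,b}$ on $\mathbb{R}^8$ is absolutely irreducible. It has precisely one nontrivial isotropy type, and the corresponding fixed point space is $4$-dimensional.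
   Context: Let $\mathbb{A}$ be the set of all finite products $\prod_{i=1}^r a_i^{s_i}$ with $r\ge1$, $s_i\ge1$ and primes $a_i\equiv 1 \bmod 4$. For each $a\in\mathbb{A}$ fix (once and for all) an odd $\rho\in\{0,\dots,a-1\}$ with $\rho^2\equiv -1\bmod a$ (such $\rho$ exists). Let $\mathbf{r}(\psi)=\begin{pmatrix}\cos\psi&-\sin\psi\\ \sin\psi&\cos\psi\end{pmatrix}$ and $$c=\begin{pmatrix}\mathbf{r}(\pi/a)&0\\0&\mathbf{r}(\pi/a)\end{pmatrix},\quad d=\begin{pmatrix}\mathbf{r}(-\pi/b)&0\\0&\mathbf{r}(\pi/b)\end{pmatrix},$$ $$q=\begin{pmatrix}0&0&1&0\\0&0&0&1\\-1&0&0&0\\0&-1&0&0\end{pmatrix},\quad s=\begin{pmatrix}0&0&-1&0\\0&0&0&1\\1&0&0&0\\0&-1&0&0\end{pmatrix}.$$ For $a\in\mathbb{A}$ and odd $b\ge3$ with $\gcd(a,b)=1$ define, in $4\times4$ blocks, $$C=\begin{pmatrix}c&0\\0&c^\rho\end{pmatrix},\ D=\begin{pmatrix}d&0\\0&d\end{pmatrix},\ Q=\begin{pmatrix}q&0\\0&-q\end{pmatrix},\ S=\begin{pmatrix}s&0\\0&s\end{pmatrix},\ V=\begin{pmatrix}0&\mathbf{1}_4\\ s&0\end{pmatrix},$$ and $G_{a,b}=\langle C,D,Q,S,V\rangle$ ($C$ depends on $a$, $D$ on $b$). A real representation is absolutely irreducible if the only linear maps commuting with the group action are real multiples of the identity.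 The isotropy subgroup of a point $x$ is its stabilizer; an isotropy type is a conjugacy class of isotropy subgroups. It is nontrivial if the subgroups in it are neither the trivial group nor the whole group. The fixed point space of a subgroup $K$ is $\mathrm{Fix}(K)=\{x: kx=x \text{ for all } k\in K\}$. *)

(* Defs.v *)
From HB Require Import structures.
From mathcomp Require Import all_boot all_order all_algebra.
From mathcomp Require Import all_classical all_reals all_analysis.

Set Implicit Arguments.
Unset Strict Implicit.
Unset Printing Implicit Defensive.

Import Order.TTheory GRing.Theory Num.Theory.

Local Open Scope classical_set_scope.
Local Open Scope ring_scope.

(* A product of prime powers is encoded by the list of its pairs (a_i, s_i);
   as usual a_i may repeat, which does not change the set of products. *)
Definition setA : set nat := [set a |
  exists l : seq (nat * nat),
    [/\ (0 < size l)%N,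
        forall u, u \in l -> [/\ prime u.1, u.1 = 1 %[mod 4] & (0 < u.2)%N] &
        a = (\prod_(u <- l) u.1 ^ u.2)%N]].

(* A choice function a |-> rho for all a in setA simultaneously: rho may depend
   on a only (in particular not on b). *)
Definition root_choice (rho : nat -> nat) : Prop :=
  forall a, setA a ->
    [/\ odd (rho a), (rho a < a)%N & ((rho a)%:Z ^+ 2 = -1 %[mod a%:Z])%Z].

Section MatrixGroups.
Variables (R : realType) (n : nat).
Implicit Types (G H K S : set 'M[R]_n) (x : 'cV[R]_n).

Definition GL : set 'M[R]_n := [set g | g \in unitmx].

Definition matrix_group H : Prop :=
  [/\ H `<=` GL, H 1%:M,
      forall g h, H g -> H h -> H (g *m h) &
      forall g, H g -> H (invmx g)].

(* Intended for S `<=` GL; otherwise no matrix_group contains S. *)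
Definition generated S : set 'M[R]_n := smallest matrix_group S.

Definition subgroup H K : Prop :=
  [/\ matrix_group H, matrix_group K & H `<=` K].

Definition orthogonal_group : set 'M[R]_n := [set g | g *m g^T = 1%:M].

Definition absolutely_irreducible G : Prop :=
  forall f : {linear 'cV[R]_n -> 'cV[R]_n},
    (forall g x, G g -> f (g *m x) = g *m f x) ->
    exists t : R, forall x, f x = t *: x.

Definition isotropy G x : set 'M[R]_n := [set g | G g /\ g *m x = x].

Definition conjugate H (g : 'M[R]_n) : set 'M[R]_n :=
  [set g *m h *m invmx g | h in H].

Definition conjugacy_class G H : set (set 'M[R]_n) :=
  [set conjugate H g | g in G].

Definition isotropy_types G : set (set (set 'M[R]_n)) :=
  [set conjugacy_class G (isotropy G x) | x in [set: 'cV[R]_n]].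

Definition nontrivial_isotropy_types G : set (set (set 'M[R]_n)) :=
  [set T | isotropy_types G T /\
           forall K, T K -> K <> [set 1%:M] /\ K <> G].

Definition Fix K : set 'cV[R]_n := [set x | forall k, K k -> k *m x = x].

Definition has_dimension (F : set 'cV[R]_n) (k : nat) : Prop :=
  exists2 W : {vspace 'cV[R]_n}, F = [set` W] & \dim W = k.

End MatrixGroups.

Arguments GL : clear implicits.
Arguments orthogonal_group : clear implicits.

Section Generators.
Variable R : realType.

Definition rotation (psi : R) : 'M[R]_2 :=
  \matrix_(i, j) nth 0 (nth [::] [:: [:: cos psi; - sin psi];
                                     [:: sin psi; cos psi]] i) j.

Definition mx_c (a : nat) : 'M[R]_4 :=
  (block_mx (rotation (pi / a%:R)) 0 0 (rotation (pi / a%:R)) : 'M[R]_(2 + 2)).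

Definition mx_d (b : nat) : 'M[R]_4 :=
  (block_mx (rotation (- pi / b%:R)) 0 0 (rotation (pi / b%:R)) : 'M[R]_(2 + 2)).

Definition mx_q : 'M[R]_4 :=
  \matrix_(i, j) nth 0 (nth [::] [:: [::  0;  0; 1; 0];
                                     [::  0;  0; 0; 1];
                                     [:: -1;  0; 0; 0];
                                     [::  0; -1; 0; 0]] i) j.

Definition mx_s : 'M[R]_4 :=
  \matrix_(i, j) nth 0 (nth [::] [:: [:: 0;  0; -1; 0];
                                     [:: 0;  0;  0; 1];
                                     [:: 1;  0;  0; 0];
                                     [:: 0; -1;  0; 0]] i) j.

Definition mx_C (rho : nat -> nat) (a : nat) : 'M[R]_8 :=
  (block_mx (mx_c a) 0 0 (mx_c a ^+ rho a) : 'M[R]_(4 + 4)).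

Definition mx_D (b : nat) : 'M[R]_8 :=
  (block_mx (mx_d b) 0 0 (mx_d b) : 'M[R]_(4 + 4)).

Definition mx_Q : 'M[R]_8 :=
  (block_mx mx_q 0 0 (- mx_q) : 'M[R]_(4 + 4)).

Definition mx_S : 'M[R]_8 :=
  (block_mx mx_s 0 0 mx_s : 'M[R]_(4 + 4)).

Definition mx_V : 'M[R]_8 :=
  (block_mx 0 1%:M mx_s 0 : 'M[R]_(4 + 4)).

Definition Gab (rho : nat -> nat) (a b : nat) : set 'M[R]_8 :=
  generated [set mx_C rho a; mx_D b; mx_Q; mx_S; mx_V].

End Generators.

Arguments Gab : clear implicits.

(* Main.v *)
Require Import Defs.
From HB Require Import structures.
From mathcomp Require Import all_boot all_order all_algebra.
From mathcomp Require Import all_classical all_reals all_analysis.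
From mathcomp Require Import ring lra.

Set Implicit Arguments.
Unset Strict Implicit.
Unset Printing Implicit Defensive.

Import Order.TTheory GRing.Theory Num.Theory.

Local Open Scope classical_set_scope.
Local Open Scope ring_scope.

(** The space R^8 is C^4, with coordinates (z1, w1, z2, w2).  In these terms C
and D are diagonal with roots of unity as entries, Q exchanges z and w up to
sign, S = V ^+ 2 is the quaternionic structure (z, w) |-> (- w^*, z^* ) on
each half, and V exchanges the halves with one factor S.

Everything about the group itself follows from ten relations between C, D, Q
and V (record relations, verified by CDQV_relations): they allow every element
to be written C^i D^j Q^k V^l, and they identify C^a, D^b, Q^2 and V^4 with -1.
So i < 2a, j < b, k < 2, l < 4 suffice, which gives 16ab words.

A word C^i D^j multiplies each of the four coordinates by a power of a
primitive root of unity of order 2ab; as a is prime to b and to rho, and all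
three are odd, it fixes a nonzero vector only if a divides i, b divides j and
i + j is even, that is, if it is the identity (CD_free).  All other words are reduced to this case by squaring:
(C^i D^j Q)^2 = C^(2i+a) and (C^i D^j S)^2 = D^(2j+b) have odd exponents, so
they fix nothing, and an odd power of V squares to a word of the second kind
(fixing_word).  The only exceptions are the elements C^i D^j Q S, which are
involutions acting as z |-> u z^* on each coordinate, with a unit u.  The same
case analysis, with fixing a vector replaced by being 1, shows that the 16ab
words are distinct (word_inj).

The product of two of these involutions has the form C^i D^j, hence acts
freely unless it is 1: a nonzero vector is fixed by at most one of them, and
its isotropy group has order 1 or 2 (isotropy_cases).  All of them are
conjugate (refl_conj): conjugation by C^p D^q multiplies Q S by C^(2p) D^(2q),
which reaches every C^i D^j up to sign since a and b are odd, and V turns Q S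
into - Q S.  The last fact also makes the eigenspaces of Q S for 1 and -1
isomorphic, so both have dimension 4 (involution_Fix_dim).

For absolute irreducibility (comm_CDQSV_scalar), C + C^-1 is a different
scalar on each half of R^8, as cos (pi / a) <> cos (pi rho / a), so a commuting
matrix is block diagonal; c d + (c d)^-1 cuts the blocks into 2 x 2 blocks in
the same way.  The elements V and Q make these blocks equal, and a 2 x 2 matrix
that commutes with a rotation and a reflection is scalar. *)

(** * Consequences of the relations *)

(** These relations determine the group, so what concerns words alone takes
place in an arbitrary ring, where the generators are opaque.  S does not
appear because it is V ^+ 2. *)
Record relations (A : nzRingType) (a b r : nat) (C D Q V : A) : Prop :=
  Relations {
    comm_CD : C * D = D * C;
    comm_CQ : C * Q = Q * C;
    conj_DQ : D * Q * D = Q;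
    conj_VC : V * C = C ^+ r * V;
    comm_VD : V * D = D * V;
    anti_VQ : V * Q = - (Q * V);
    exp_C : C ^+ a = -1;
    exp_D : D ^+ b = -1;
    exp_Q : Q ^+ 2 = -1;
    exp_V : V ^+ 4 = -1 }.

Definition word {A : nzRingType} (C D Q V : A) (i j k l : nat) : A :=
  C ^+ i * D ^+ j * Q ^+ k * V ^+ l.

Section Words.
Variables (A : nzRingType) (a b r : nat) (C D Q V : A).
Hypotheses (ha : odd a) (hb : odd b) (hr : (2 * a %| r ^ 2 + 1)%N).
Hypothesis rel : relations a b r C D Q V.

Local Notation E := (word C D Q V).

Lemma exp_C2 : C ^+ (2 * a) = 1.
Proof. by rewrite mulnC exprM (exp_C rel) sqrrN expr1n. Qed.

Lemma exp_D2 : D ^+ (2 * b) = 1.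
Proof. by rewrite mulnC exprM (exp_D rel) sqrrN expr1n. Qed.

Lemma exp_Cdvd n : (2 * a %| n)%N -> C ^+ n = 1.
Proof. by case/dvdnP=> k ->; rewrite mulnC exprM exp_C2 expr1n. Qed.

Lemma opp_word i j k l : - E i j k l = E (i + a) j k l.
Proof. by rewrite /word exprD (exp_C rel) mulrN1 !mulNr. Qed.

Lemma mul_C_word i j k l : C * E i j k l = E i.+1 j k l.
Proof. by rewrite /word exprS !mulrA. Qed.

Lemma mul_D_word i j k l : D * E i j k l = E i j.+1 k l.
Proof.
have h : D * C ^+ i = C ^+ i * D by apply/commrX/esym/(comm_CD rel).
by rewrite /word !mulrA h exprS !mulrA.
Qed.

Lemma conj_DnQ n : D ^+ n * Q * D ^+ n = Q.
Proof.
elim: n => [|n IH]; first by rewrite expr0 mul1r mulr1.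
by rewrite {1}exprSr exprS -[RHS]IH -{2}(conj_DQ rel) !mulrA.
Qed.

(** Q inverts D; the exponent (2 * b).-1 is -1 modulo the order of D. *)
Lemma mul_Q_word i j k l : Q * E i j k l = E i ((2 * b).-1 * j) k.+1 l.
Proof.
have h : Q * C ^+ i = C ^+ i * Q by apply/commrX/esym/(comm_CQ rel).
have h2 : Q * D ^+ j = D ^+ ((2 * b).-1 * j) * Q.
  have e : D ^+ ((2 * b).-1 * j) * D ^+ j = 1.
    rewrite -exprD -{2}(mul1n j) -mulnDl addn1 prednK; last by case: b hb.
    by rewrite exprM exp_D2 expr1n.
  by rewrite -{2}(conj_DnQ j) !mulrA e mul1r.
by rewrite /word !mulrA h -(mulrA _ Q) h2 exprS !mulrA.
Qed.

Lemma V_Ci i : V * C ^+ i = C ^+ (r * i) * V.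
Proof.
elim: i => [|i IH]; first by rewrite muln0 expr0 mul1r mulr1.
by rewrite exprSr mulrA IH -mulrA (conj_VC rel) mulrA -exprD mulnS addnC.
Qed.

(** The sign of V Q = - Q V is recorded as C ^+ a. *)
Lemma V_Qk k : V * Q ^+ k = C ^+ (a * k) * Q ^+ k * V.
Proof.
elim: k => [|k IH]; first by rewrite muln0 expr0 !mul1r mulr1.
rewrite exprSr mulrA IH -!mulrA (anti_VQ rel) mulnS addnC exprD (exp_C rel).
by rewrite mulrN1 !mulNr !mulrN !mulrA.
Qed.

Lemma V_Dj j : V * D ^+ j = D ^+ j * V.
Proof. exact/commrX/(comm_VD rel). Qed.

Lemma mul_V_word i j k l : V * E i j k l = E (r * i + a * k) j k l.+1.
Proof.
have h : D ^+ j * C ^+ (a * k) = C ^+ (a * k) * D ^+ j.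
  by apply/commrX/commr_sym/commrX/(comm_CD rel).
rewrite /word !mulrA V_Ci -(mulrA _ V) V_Dj mulrA -(mulrA _ V) V_Qk.
by rewrite !mulrA -(mulrA _ (D ^+ j)) h mulrA -exprD exprS !mulrA.
Qed.

Lemma mul_CX_word n i j k l : C ^+ n * E i j k l = E (n + i) j k l.
Proof. by elim: n => [|n IH]; rewrite ?mul1r // exprS -mulrA IH mul_C_word. Qed.

Lemma mul_DX_word n i j k l : D ^+ n * E i j k l = E i (n + j) k l.
Proof. by elim: n => [|n IH]; rewrite ?mul1r // exprS -mulrA IH mul_D_word. Qed.

(** Only the exponents of Q and V are followed: they decide of which kind the
product is, trivial, a reflection or one that fixes nothing. *)
Lemma wordsM i j k l i' j' k' l' :
  exists p, E i j k l * E i' j' k' l' = E p.1 p.2 (k + k') (l + l').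
Proof.
rewrite {1}/word -!mulrA.
have [i1 ->] : exists i1, V ^+ l * E i' j' k' l' = E i1 j' k' (l + l').
  elim: l => [|l [i1 IH]]; first by exists i'; rewrite mul1r.
  by rewrite exprS -mulrA IH mul_V_word; eexists.
have [j1 ->] : exists j1, Q ^+ k * E i1 j' k' (l + l') = E i1 j1 (k + k') (l + l').
  elim: k => [|k [j1 IH]]; first by exists j'; rewrite mul1r.
  by rewrite exprS -mulrA IH mul_Q_word; eexists.
by rewrite mul_DX_word mul_CX_word; eexists (_, _).
Qed.

Lemma CD_comm i j : C ^+ i * D ^+ j = D ^+ j * C ^+ i.
Proof. by apply/commrX/commr_sym/commrX/esym/(comm_CD rel). Qed.

(** The factors 3 and 7 are -1 modulo the orders 4 and 8 of Q and V. *)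
Lemma word_inv i j k l : exists p, E i j k l * E p.1 p.2 (3 * k) (7 * l) = 1.
Proof.
have V8 : V ^+ l * V ^+ (7 * l) = 1.
  by rewrite -exprD -mulSn exprM (exprM V 4 2) (exp_V rel) sqrrN !expr1n.
have Q4 : Q ^+ k * Q ^+ (3 * k) = 1.
  by rewrite -exprD -mulSn exprM (exprM Q 2 2) (exp_Q rel) sqrrN !expr1n.
have D2 : D ^+ j * D ^+ ((2 * b).-1 * j) = 1.
  by rewrite -exprD -mulSn prednK ?(exprM D (2 * b)) ?exp_D2 ?expr1n //; case: b hb.
have C2 : C ^+ i * C ^+ ((2 * a).-1 * i) = 1.
  by rewrite -exprD -mulSn prednK ?(exprM C (2 * a)) ?exp_C2 ?expr1n //; case: a ha.
set i' := (_ * i)%N in C2; set j' := (_ * j)%N in D2.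
have [p e1] := wordsM 0 0 (3 * k) 0 i' j' 0 0.
have [q e2] := wordsM 0 0 0 (7 * l) p.1 p.2 (3 * k) 0.
exists q; move: e1 e2; rewrite !addn0 !add0n => <- <-.
rewrite /word !expr0 !mul1r !mulr1 CD_comm.
by rewrite -!mulrA (mulrA (V ^+ l)) V8 mul1r (mulrA (Q ^+ k)) Q4 mul1r
  (mulrA (C ^+ i)) C2 mul1r D2.
Qed.

(** The sign coming from Q ^+ 2 = V ^+ 4 = -1 is absorbed by C ^+ a = -1. *)
Lemma word_mod i j k l :
  E i j k l = E (i + a * (k %/ 2 + l %/ 4)) j (k %% 2) (l %% 4).
Proof.
have hk : Q ^+ k = (-1) ^+ (k %/ 2) * Q ^+ (k %% 2).
  by rewrite {1}(divn_eq k 2) exprD mulnC exprM (exp_Q rel).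
have hl : V ^+ l = (-1) ^+ (l %/ 4) * V ^+ (l %% 4).
  by rewrite {1}(divn_eq l 4) exprD mulnC exprM (exp_V rel).
rewrite /word hk hl exprD exprM (exp_C rel).
rewrite [in RHS]exprD -[(-1) ^+ (k %/ 2)]signr_odd -[(-1) ^+ (l %/ 4)]signr_odd.
by case: odd; case: odd;
  rewrite ?(expr0, expr1, mulr1, mul1r, mulrN1, mulN1r, mulrN, mulNr, opprK).
Qed.

(** V acts on C by the exponent r, so V ^+ 2 acts by r ^ 2, which is -1 modulo
2 * a: this is what makes V ^+ 2 invert C. *)
Lemma mul_cV2C n : C ^+ n * V ^+ 2 * C ^+ n = V ^+ 2.
Proof.
have VC : V ^+ 2 * C ^+ n = C ^+ (r ^ 2 * n) * V ^+ 2.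
  by rewrite expr2 -mulrA V_Ci mulrA V_Ci -!mulrA mulnA.
rewrite -mulrA VC mulrA -exprD -{1}(mul1n n) -mulnDl addnC.
by rewrite exp_Cdvd ?mul1r // dvdn_mulr.
Qed.

Lemma V2_D n : V ^+ 2 * D ^+ n = D ^+ n * V ^+ 2.
Proof. by apply/commrX/commr_sym/commrX/esym/(comm_VD rel). Qed.

Lemma V2_Q : V ^+ 2 * Q = Q * V ^+ 2.
Proof.
by rewrite expr2 -mulrA (anti_VQ rel) mulrN !mulrA (anti_VQ rel) mulNr opprK.
Qed.

(** In the matrix group this is Q S, the conjugation (z1, w1, z2, w2) |->
(z1^*, w1^*, - z2^*, - w2^* ). *)
Definition reflection : A := Q * V ^+ 2.

Lemma conj_C_refl n : C ^+ n * reflection * C ^+ n = reflection.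
Proof.
have h : C ^+ n * Q = Q * C ^+ n by apply/commr_sym/commrX/esym/(comm_CQ rel).
rewrite /reflection; move: (V ^+ 2) (mul_cV2C n) => W hW.
by rewrite !mulrA h -!mulrA (mulrA _ W) hW.
Qed.

Lemma conj_D_refl n : D ^+ n * reflection * D ^+ n = reflection.
Proof.
rewrite /reflection; move: (V ^+ 2) (V2_D n) => W hW.
by rewrite -!mulrA hW !mulrA conj_DnQ.
Qed.

Lemma refl_sq : reflection * reflection = 1.
Proof.
have := exp_V rel; rewrite (exprD _ 2 2) /reflection.
move: (V ^+ 2) V2_Q => W hW hW2.
by rewrite -mulrA (mulrA W) hW -mulrA hW2 !mulrN1 mulrN -expr2 (exp_Q rel) opprK.
Qed.

Lemma anti_V_refl : V * reflection = - (reflection * V).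
Proof.
have hW : V * V ^+ 2 = V ^+ 2 * V by rewrite -exprS -exprSr.
rewrite /reflection; move: (V ^+ 2) hW => W hW.
by rewrite mulrA (anti_VQ rel) mulNr -!mulrA hW.
Qed.

Lemma word_refl i j : E i j 1 2 = C ^+ i * D ^+ j * reflection.
Proof. by rewrite /word /reflection expr1 mulrA. Qed.

Lemma conj_CD_refl i j : C ^+ i * D ^+ j * reflection * (C ^+ i * D ^+ j) = reflection.
Proof.
rewrite {2}CD_comm; move: reflection (conj_C_refl i) (conj_D_refl j) => P hC hD.
by rewrite -!mulrA (mulrA P) (mulrA (D ^+ j)) (mulrA _ P) hD mulrA hC.
Qed.

Lemma word_refl_sq i j : E i j 1 2 * E i j 1 2 = 1.
Proof. by rewrite !word_refl mulrA conj_CD_refl refl_sq. Qed.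

(** Conjugation by C ^+ p * D ^+ q multiplies the reflection by
C ^+ (2 * p) * D ^+ (2 * q).  Since a and b are odd, adding a to i, or b to j,
makes the exponent even at the cost of a sign, and V changes the sign of the
reflection. *)
Lemma refl_conj i j :
  exists p q e, E i j 1 2 * E p q 0 e = E p q 0 e * reflection.
Proof.
pose p := (i + a * odd i)./2; pose q := (j + b * odd j)./2.
have hC : C ^+ i = (-1) ^+ odd i * C ^+ p ^+ 2.
  rewrite -exprM muln2 even_halfK; last by rewrite oddD oddM ha oddb addbb.
  rewrite exprD exprM (exp_C rel).
  by case: odd; rewrite ?mul1r ?mulr1 ?expr1 ?mulN1r ?mulrN1 ?opprK.
have hD : D ^+ j = (-1) ^+ odd j * D ^+ q ^+ 2.
  rewrite -exprM muln2 even_halfK; last by rewrite oddD oddM hb oddb addbb.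
  rewrite exprD exprM (exp_D rel).
  by case: odd; rewrite ?mul1r ?mulr1 ?expr1 ?mulN1r ?mulrN1 ?opprK.
exists p, q, (odd i (+) odd j : nat).
have -> : E p q 0 (odd i (+) odd j) = C ^+ p * D ^+ q * V ^+ (odd i (+) odd j).
  by rewrite /word expr0 mulr1.
have hCD : C ^+ i * D ^+ j =
    (-1) ^+ (odd i (+) odd j) * (C ^+ p * D ^+ q * (C ^+ p * D ^+ q)).
  rewrite hC hD !expr2; move: (C ^+ p) (D ^+ q) (CD_comm p q) => X Y hXY.
  have -> : X * Y * (X * Y) = X * X * (Y * Y).
    by rewrite -!mulrA (mulrA Y X) -hXY -!mulrA.
  by case: odd; case: odd;
    rewrite ?expr0 ?expr1 ?mulN1r ?mulNr ?mulrN ?opprK ?mul1r.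
rewrite word_refl hCD; move: (C ^+ p * D ^+ q) reflection (conj_CD_refl p q) anti_V_refl.
move=> g P hg hV; case: addb; rewrite ?expr0 ?expr1 ?mulN1r ?mul1r ?mulr1.
  by rewrite -(mulrA g V) hV !mulNr mulrN !mulrA -(mulrA g g P) -(mulrA g _ g) hg.
by rewrite -(mulrA g g P) -(mulrA g _ g) hg.
Qed.

(** The predicate P is a common generalization of fixing a given nonzero vector
and of being equal to 1; the former yields the isotropy groups, the latter the
order of the group. *)
Section Fixing.
Variable P : A -> Prop.
Hypothesis PM : forall g h, P g -> P h -> P (g * h).
Hypothesis free : forall i j, P (C ^+ i * D ^+ j) ->
  [/\ (a %| i)%N, (b %| j)%N & ~~ odd (i + j)].

Lemma fixing_CD_trivial i j : P (C ^+ i * D ^+ j) -> C ^+ i * D ^+ j = 1.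
Proof.
case/free=> /dvdnP[u ->] /dvdnP[v ->].
rewrite oddD !oddM ha hb !andbT mulnC (mulnC v) !exprM (exp_C rel) (exp_D rel).
by rewrite -signr_odd -(signr_odd _ v); case: odd; case: odd;
  rewrite ?expr0 ?expr1 ?mulrNN ?mulr1.
Qed.

(** The square is C ^+ (2 * i + a), of odd exponent, while words C ^+ i * D ^+ j
that satisfy P have i + j even. *)
Lemma not_fixing_Q i j : ~ P (E i j 1 0).
Proof.
move=> Pg; have := PM Pg Pg.
have -> : E i j 1 0 * E i j 1 0 = C ^+ (i + i + a) * D ^+ 0.
  have hQC : Q * C ^+ i = C ^+ i * Q by apply/commrX/esym/(comm_CQ rel).
  rewrite /word !expr0 expr1 !mulr1 !exprD (exp_C rel) mulrN1.
  move: (C ^+ i) (D ^+ j) (CD_comm i j) hQC (conj_DnQ j) => c d hcd hQc hdQ.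
  rewrite -!mulrA (mulrA Q c) hQc -!mulrA (mulrA d c) -hcd -!mulrA.
  by rewrite (mulrA d Q) (mulrA _ d) hdQ -expr2 (exp_Q rel) !mulrN1 mulrN.
by case/free=> _ _; rewrite addn0 oddD addnn odd_double ha.
Qed.

(** The square is D ^+ (2 * j + b), because V ^+ 2 commutes with D and inverts
C. *)
Lemma not_fixing_V2 i j : ~ P (E i j 0 2).
Proof.
move=> Pg; have := PM Pg Pg.
have -> : E i j 0 2 * E i j 0 2 = C ^+ 0 * D ^+ (j + j + b).
  rewrite /word !expr0 !mulr1 mul1r !exprD (exp_D rel) mulrN1.
  have := exp_V rel; rewrite (exprD _ 2 2); move: (V2_D j) (mul_cV2C i).
  move: (C ^+ i) (D ^+ j) (CD_comm i j) (V ^+ 2) => c d hcd W hWd hcW hW.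
  rewrite hcd -!mulrA (mulrA W d) hWd -!mulrA (mulrA c d) hcd -!mulrA.
  by rewrite (mulrA c W) (mulrA (c * W) c) hcW hW !mulrN1 mulrN.
by case/free=> _ _; rewrite add0n oddD addnn odd_double hb.
Qed.

(** An odd power of V squares to a word with V ^+ 2 and an even power of Q, which
is excluded already; this leaves the trivial words and the reflections. *)
Lemma fixing_word i j k l : P (E i j k l) ->
  (k %% 2 = 0)%N /\ (l %% 4 = 0)%N \/ (k %% 2 = 1)%N /\ (l %% 4 = 2)%N.
Proof.
rewrite word_mod; move: (_ + _)%N => i'.
have := ltn_pmod k (isT : 0 < 2)%N; have := ltn_pmod l (isT : 0 < 4)%N.
move: (k %% 2)%N (l %% 4)%N => k' l' lk ll Pg.
have l'even : ~~ odd l'.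
  apply/negP=> ol; have := PM Pg Pg; have [p ->] := wordsM i' j k' l' i' j k' l'.
  (* V ^+ 3 squares to V ^+ 6 = - V ^+ 2 *)
  have -> : (l' + l' = (l' == 3) * 4 + 2)%N by case: l' lk ol {Pg} => [|[|[|[|]]]].
  rewrite word_mod modnMDl addnn -muln2 modnMl; exact: not_fixing_V2.
case: k' l' lk ll l'even Pg => [|[|//]] [|[|[|[|//]]]] // _ _ _.
- by left.
- by move/not_fixing_V2.
- by move/not_fixing_Q.
- by right.
Qed.

Lemma fixing_word_cases i j k l : P (E i j k l) ->
  E i j k l = 1 \/ exists i', E i j k l = E i' j 1 2.
Proof.
move=> Pg; have := fixing_word Pg; move: Pg; rewrite word_mod.
move=> Pg [[k0 l0]|[k1 l2]]; last by right; rewrite k1 l2; eexists.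
left; move: Pg; rewrite k0 l0 /word 2!expr0 !mulr1; exact: fixing_CD_trivial.
Qed.

(** The product of two reflections is some C ^+ u * D ^+ v, which satisfies P only
if it is 1; and reflections are involutions. *)
Lemma fixing_refl_uniq i j i' j' :
  P (E i j 1 2) -> P (E i' j' 1 2) -> E i j 1 2 = E i' j' 1 2.
Proof.
move=> Ph Ph'; have := PM Ph Ph'; have [p ep] := wordsM i j 1 2 i' j' 1 2.
have wCD u v : E u v 0 0 = C ^+ u * D ^+ v by rewrite /word !expr0 !mulr1.
have {}ep : E i j 1 2 * E i' j' 1 2 = C ^+ (p.1 + a * 2) * D ^+ p.2.
  by rewrite ep word_mod -wCD.
rewrite ep => /fixing_CD_trivial e1; rewrite e1 in ep.
by rewrite -[LHS]mulr1 -(word_refl_sq i' j') mulrA ep mul1r.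
Qed.

End Fixing.

Section Counting.
Hypothesis a_gt1 : (1 < a)%N.
Hypothesis free : forall i j, C ^+ i * D ^+ j = 1 ->
  [/\ (a %| i)%N, (b %| j)%N & ~~ odd (i + j)].

(** Among the words left by fixing_word, a reflection cannot be 1: it inverts C,
and C ^+ 2 <> 1 since a is odd and not 1. *)
Lemma word_eq1 i j k l : E i j k l = 1 -> (k %% 2 = 0)%N /\ (l %% 4 = 0)%N.
Proof.
move=> E1.
have PM (g h : A) : g = 1 -> h = 1 -> g * h = 1 by move=> -> ->; rewrite mulr1.
have [//|[k1 l2]] := fixing_word (P := fun g => g = 1) PM free E1.
move: E1; rewrite word_mod k1 l2; move: (_ + _)%N => i' E1.
have h : C ^+ 1 * E i' j 1 2 * C ^+ 1 = E i' j 1 2.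
  rewrite word_refl; move: reflection (conj_C_refl 1) => W hW; rewrite -[in RHS]hW.
  rewrite !mulrA; congr (_ * _ * _).
  by rewrite -[RHS]mulrA -CD_comm mulrA -!exprD addnC.
have C2 : C ^+ 2 * D ^+ 0 = 1 by rewrite mulr1 expr2 -[RHS]E1 -h E1 mulr1.
have [/(dvdn_leq (isT : 0 < 2)%N) a_le2 _ _] := free C2.
by case: (a) a_gt1 ha a_le2 => [|[|[|]]].
Qed.

(** The quotient of the two words is 1, so word_eq1 yields k = k' and l = l'.
Then C ^+ (i - i') * D ^+ (j - j') = 1, where i' and j' are subtracted from the
multiples 2 * a and 2 * b of the orders to stay in nat; freeness gives i and i'
modulo a and modulo 2. *)
Lemma word_inj i j k l i' j' k' l' :
  (i < 2 * a)%N -> (j < b)%N -> (k < 2)%N -> (l < 4)%N ->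
  (i' < 2 * a)%N -> (j' < b)%N -> (k' < 2)%N -> (l' < 4)%N ->
  E i j k l = E i' j' k' l' -> [/\ i = i', j = j', k = k' & l = l'].
Proof.
move=> li lj lk ll li' lj' lk' ll' eE.
have [p' e'] := word_inv i' j' k' l'.
have [p ep] := wordsM i j k l p'.1 p'.2 (3 * k') (7 * l').
move: ep; rewrite eE e' => /esym/word_eq1[ek el].
have ekk : k = k' by case: k k' lk lk' ek {eE e'} => [|[|//]] [|[|//]].
have ell : l = l'.
  by case: l l' ll ll' el {eE e'} => [|[|[|[|//]]]] [|[|[|[|//]]]].
have eCD : C ^+ i * D ^+ j = C ^+ i' * D ^+ j'.
  have [u eu] := word_inv 0 0 k l; rewrite /word !mul1r in eu.
  rewrite -[LHS]mulr1 -eu -[RHS]mulr1 -eu !mulrA.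
  by move: eE; rewrite /word ekk ell => ->.
have /free[ai bj] : C ^+ (i + (2 * a - i')) * D ^+ (j + (2 * b - j')) = 1.
  rewrite 2!exprD mulrA -(mulrA (C ^+ i)) (CD_comm _ j) mulrA eCD.
  rewrite -(mulrA (C ^+ i')) -(CD_comm _ j') mulrA -exprD subnKC 1?ltnW // exp_C2.
  by rewrite mul1r -exprD subnKC ?exp_D2 // ltnW // (leq_trans lj') // leq_pmull.
have ejj : j = j'.
  apply/eqP; rewrite -(modn_small lj) -(modn_small lj') -(eqn_modDr (2 * b - j')).
  by rewrite subnKC ?modnMl // ltnW // (leq_trans lj') // leq_pmull.
move=> oij; split=> //.
have oii : odd i = odd i'.
  have lj'2 : (j' <= 2 * b)%N by rewrite ltnW // (leq_trans lj') // leq_pmull.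
  move: oij; rewrite ejj (subnKC lj'2) !oddD (oddB (ltnW li')) !oddM /= addbF.
  by rewrite addbb addbF; case: (odd i); case: (odd i').
have /eqP : (i == i' %[mod 2 * a])%N.
  rewrite chinese_remainder ?coprime2n ?ha // !modn2 oii eqxx /=.
  rewrite -(eqn_modDr (2 * a - i')) subnKC 1?ltnW // modnMl.
  exact: ai.
by rewrite !modn_small.
Qed.
End Counting.
End Words.

(** * Plane rotations *)

Section Rotations.
Variable R : realType.
Implicit Types x y : R.

(** Complex conjugation on R^2 = C. *)
Definition axial_symmetry : 'M[R]_2 := \matrix_(i, j) ((-1) ^+ i *+ (i == j)).

Lemma rotationD x y : rotation (x + y) = rotation x * rotation y.
Proof.
apply/matrixP=> i j; rewrite !mxE !big_ord_recl big_ord0 !mxE cosD sinD addr0.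
by case: i j => [[|[|//]] ?] [[|[|//]] ?] /=; ring.
Qed.

Lemma rotation0 : rotation (0 : R) = 1.
Proof.
apply/matrixP=> i j; rewrite !mxE cos0 sin0 oppr0.
by case: i j => [[|[|//]] ?] [[|[|//]] ?].
Qed.

Lemma rotation_pi : rotation (pi : R) = -1.
Proof.
apply/matrixP=> i j; rewrite !mxE cospi sinpi oppr0.
by case: i j => [[|[|//]] ?] [[|[|//]] ?]; rewrite ?oppr0.
Qed.

Lemma rotationX x n : rotation x ^+ n = rotation (x *+ n).
Proof.
elim: n => [|n IH]; first by rewrite rotation0.
by rewrite exprS IH -rotationD -mulrS.
Qed.

Lemma rotationC x y : rotation x * rotation y = rotation y * rotation x.
Proof. by rewrite -!rotationD addrC. Qed.

Lemma rotationNK x : rotation (- x) * rotation x = 1.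
Proof. by rewrite -rotationD addNr rotation0. Qed.

Lemma rotation_tr x : (rotation x)^T = rotation (- x).
Proof.
apply/matrixP=> i j; rewrite !mxE cosN sinN opprK.
by case: i j => [[|[|//]] ?] [[|[|//]] ?].
Qed.

Lemma rotation_half n : (0 < n)%N -> rotation (pi / n%:R : R) ^+ n = -1.
Proof.
by move=> n0; rewrite rotationX -(mulr_natr (pi / _)) divfK ?rotation_pi // pnatr_eq0 -lt0n.
Qed.

Lemma axial_symmetry_rotation x :
  axial_symmetry * rotation x = rotation (- x) * axial_symmetry.
Proof.
apply/matrixP=> i j; rewrite !mxE !big_ord_recl !big_ord0 !mxE cosN sinN.
by case: i j => [[|[|//]] ?] [[|[|//]] ?] /=; ring.
Qed.

Lemma axial_symmetry_sq : axial_symmetry * axial_symmetry = 1.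
Proof.
apply/matrixP=> i j; rewrite !mxE !big_ord_recl !big_ord0 !mxE.
by case: i j => [[|[|//]] ?] [[|[|//]] ?] /=; ring.
Qed.

Lemma rotation_fixed x (v : 'cV[R]_2) :
  rotation x *m v = v -> v != 0 -> cos x = 1.
Proof.
move=> /matrixP fv; apply: contra_neq_eq => cx1.
have e0 := fv 0 0; have e1 := fv 1 0.
rewrite !mxE !big_ord_recl !big_ord0 !mxE /= !addr0 in e0 e1.
have v1 : v (lift ord0 ord0) 0 = v 1 0 by congr (v _ 0); apply: val_inj.
rewrite v1 in e0 e1; have pyt := cos2Dsin2 x.
have h : 2 * (1 - cos x) * v 0 0 = 0.
  transitivity ((1 - cos x) * (v 0 0 - (cos x * v 0 0 + - sin x * v 1 0)) +
    sin x * (sin x * v 0 0 + cos x * v 1 0 - v 1 0) +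
    (1 - (cos x ^+ 2 + sin x ^+ 2)) * v 0 0); first by ring.
  by rewrite pyt e0 e1 !subrr !mulr0 mul0r !addr0.
have h2 : 2 * (1 - cos x) * v 1 0 = 0.
  transitivity ((1 - cos x) * (v 1 0 - (sin x * v 0 0 + cos x * v 1 0)) -
    sin x * (cos x * v 0 0 + - sin x * v 1 0 - v 0 0) +
    (1 - (cos x ^+ 2 + sin x ^+ 2)) * v 1 0); first by ring.
  by rewrite pyt e0 e1 !subrr !mulr0 mul0r !subr0 addr0.
have nz : 2 * (1 - cos x) != 0.
  by rewrite mulf_neq0 ?pnatr_eq0 // subr_eq0 eq_sym.
move/eqP: h; rewrite mulf_eq0 (negbTE nz) => /eqP p0.
move/eqP: h2; rewrite mulf_eq0 (negbTE nz) => /eqP q0.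
apply/matrixP=> i j; rewrite ord1 mxE.
case: i => [[|[|//]] h]; [rewrite -p0|rewrite -q0]; congr (v _ 0); exact: val_inj.
Qed.

(** With k the remainder of n modulo 2 * m, the half-angle formula writes
cos (pi k / m) = 1 as sin (pi k / (2 m)) = 0, and the angle is less than pi. *)
Lemma rotation_fixed_dvd m n (v : 'cV[R]_2) : (0 < m)%N ->
  rotation (pi / m%:R) ^+ n *m v = v -> v != 0 -> (2 * m %| n)%N.
Proof.
move=> m0; have m0R : m%:R != 0 :> R by rewrite pnatr_eq0 -lt0n.
rewrite (divn_eq n (2 * m)) mulnC exprD exprM exprM.
rewrite (_ : rotation (pi / m%:R) ^+ 2 ^+ m = 1); last first.
  by rewrite exprAC rotation_half // sqrrN expr1n.
rewrite expr1n mul1r rotationX => h /(rotation_fixed h).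
have: (n %% (2 * m) < 2 * m)%N by rewrite ltn_pmod // muln_gt0.
move: (n %% _)%N => k lk; case: (posnP k) => [-> _|k0].
  by rewrite addn0 dvdn_mulr.
have -> : pi / m%:R *+ k = (pi * k%:R / (2 * m)%:R) *+ 2 :> R.
  rewrite natrM -(mulr_natr (pi / _)) -(mulr_natr (_ / _) 2).
  by field; rewrite m0R ?pnatr_eq0.
rewrite cos_mulr2n.
have : 0 < sin (pi * k%:R / (2 * m)%:R : R).
  apply: sin_gt0_pi; rewrite divr_gt0 ?mulr_gt0 ?pi_gt0 ?ltr0n ?muln_gt0 //=.
  by rewrite ltr_pdivrMr ?ltr0n ?muln_gt0 // ltr_pM2l ?pi_gt0 // ltr_nat.
move: (cos2Dsin2 (pi * k%:R / (2 * m)%:R : R)).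
move: (cos _) (sin _) => c s; nra.
Qed.

End Rotations.

(** * The block matrices satisfy the relations *)

Section Blocks.
Variable R : realType.

(** The product is the one of the ring of square matrices, as in the powers that
occur in the generators; the size n has to be given explicitly to recognize 4
and 8 as sums. *)
Lemma block_mxM n (A B C D A' B' C' D' : 'M[R]_n) :
  block_mx A B C D * block_mx A' B' C' D' =
  block_mx (A * A' + B * C') (A * B' + B * D')
           (C * A' + D * C') (C * B' + D * D') :> 'M[R]_(n + n).
Proof. exact: mulmx_block. Qed.

Lemma block_mx1 n : 1 = block_mx 1 0 0 1 :> 'M[R]_(n + n).
Proof. exact: scalar_mx_block. Qed.

Lemma diag_block_mxX n (A B : 'M[R]_n) k :
  (block_mx A 0 0 B : 'M[R]_(n + n)) ^+ k = block_mx (A ^+ k) 0 0 (B ^+ k).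
Proof.
elim: k => [|k IH]; first by rewrite !expr0 block_mx1.
by rewrite !exprS IH block_mxM !mul0r !mulr0 !addr0 !add0r.
Qed.

Local Notation sg := (axial_symmetry R).

Lemma mx_qE : mx_q R = (block_mx 0 1 (-1) 0 : 'M[R]_(2 + 2)).
Proof.
apply/matrixP=> i j; rewrite !mxE.
case: splitP => i' ei; rewrite !mxE; case: splitP => j' ej; rewrite !mxE ei ej;
by case: i' j' {ei ej} => [[|[|//]] ?] [[|[|//]] ?] /=; rewrite ?oppr0.
Qed.

Lemma mx_sE : mx_s R = (block_mx 0 (- sg) sg 0 : 'M[R]_(2 + 2)).
Proof.
apply/matrixP=> i j; rewrite !mxE.
case: splitP => i' ei; rewrite !mxE; case: splitP => j' ej; rewrite !mxE ei ej;
by case: i' j' {ei ej} => [[|[|//]] ?] [[|[|//]] ?] /=; rewrite ?oppr0 ?opprK.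
Qed.

Let bsimp := (@block_mxM 2, mul0r, mulr0, addr0, add0r, mulr1, mul1r,
  mulN1r, mulrN1, mulNr, mulrN, @opprK).

Lemma comm_cd a b : mx_c R a * mx_d R b = mx_d R b * mx_c R a.
Proof. by rewrite /mx_c /mx_d !bsimp !(rotationC (pi / a%:R)). Qed.

Lemma comm_cq a : mx_c R a * mx_q R = mx_q R * mx_c R a.
Proof. by rewrite /mx_c mx_qE !bsimp. Qed.

Lemma conj_dq b : mx_d R b * mx_q R * mx_d R b = mx_q R.
Proof. by rewrite /mx_d mx_qE !bsimp rotationNK rotationC rotationNK. Qed.

Lemma conj_cs a : mx_c R a * mx_s R * mx_c R a = mx_s R.
Proof.
rewrite /mx_c mx_sE !bsimp -!mulrA axial_symmetry_rotation mulrA rotationC.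
by rewrite rotationNK mul1r.
Qed.

Lemma comm_sd b : mx_s R * mx_d R b = mx_d R b * mx_s R.
Proof.
by rewrite /mx_d mx_sE !bsimp !axial_symmetry_rotation opprK.
Qed.

Lemma comm_sq : mx_s R * mx_q R = mx_q R * mx_s R.
Proof. by rewrite mx_sE mx_qE !bsimp. Qed.

Lemma exp_c a : (0 < a)%N -> mx_c R a ^+ a = -1.
Proof.
move=> a0; rewrite /mx_c (diag_block_mxX (n := 2)) rotation_half // (block_mx1 2).
by rewrite (opp_block_mx (1 : 'M[R]_2)) !oppr0.
Qed.

Lemma exp_d b : (0 < b)%N -> mx_d R b ^+ b = -1.
Proof.
move=> b0; rewrite /mx_d (diag_block_mxX (n := 2)) rotation_half //.
have -> : rotation (- pi / b%:R : R) ^+ b = -1.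
  have h := rotation_half R b0.
  have : rotation (- pi / b%:R : R) ^+ b * rotation (pi / b%:R : R) ^+ b = 1.
    by rewrite -exprMn_comm ?mulNr ?rotationNK ?expr1n //; apply: rotationC.
  by rewrite h mulrN1 => /eqP; rewrite eqr_oppLR => /eqP.
by rewrite (block_mx1 2) (opp_block_mx (1 : 'M[R]_2)) !oppr0.
Qed.

Lemma exp_q : mx_q R ^+ 2 = -1.
Proof.
rewrite expr2 mx_qE !bsimp (block_mx1 2).
by rewrite (opp_block_mx (1 : 'M[R]_2)) !oppr0.
Qed.

Lemma exp_s : mx_s R ^+ 2 = -1.
Proof.
rewrite expr2 mx_sE !bsimp axial_symmetry_sq (block_mx1 2).
by rewrite (opp_block_mx (1 : 'M[R]_2)) !oppr0.
Qed.

Let bsimp4 := (@block_mxM 4, mul0r, mulr0, addr0, add0r, mulr1, mul1r,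
  mulN1r, mulrN1, mulNr, mulrN, @opprK).

Lemma mx_VV : mx_V R * mx_V R = mx_S R.
Proof. by rewrite /mx_V /mx_S !bsimp4. Qed.

(** V C = C ^+ rho V holds on the first half because V exchanges the halves, and
on the second half because s inverts c, as does c ^+ (rho ^ 2). *)
Lemma CDQV_relations rho a b : (0 < a)%N -> (0 < b)%N -> odd (rho a) ->
  (2 * a %| rho a ^ 2 + 1)%N ->
  relations a b (rho a) (mx_C R rho a) (mx_D R b) (mx_Q R) (mx_V R).
Proof.
move=> a0 b0 orho hrho.
have c2a : mx_c R a ^+ (2 * a) = 1 by rewrite mulnC exprM exp_c // sqrrN expr1n.
have opp8 : -1 = (block_mx (-1) 0 0 (-1) : 'M[R]_(4 + 4)) :> 'M[R]_8.
  by rewrite (block_mx1 4) (opp_block_mx (1 : 'M[R]_4)) !oppr0.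
have hcd : mx_d R b * mx_c R a ^+ rho a = mx_c R a ^+ rho a * mx_d R b.
  exact/commrX/esym/comm_cd.
have hcq : mx_q R * mx_c R a ^+ rho a = mx_c R a ^+ rho a * mx_q R.
  exact/commrX/esym/comm_cq.
have hcs : mx_s R * mx_c R a = mx_c R a ^+ rho a ^+ rho a * mx_s R.
  rewrite -[in RHS](conj_cs a) !mulrA -exprM -exprSr mulnn -(addn1 (_ ^ 2)).
  by have /dvdnP[k ->] := hrho; rewrite (mulnC k) (exprM _ (2 * a)) c2a expr1n mul1r.
have VV : mx_V R ^+ 2 = mx_S R by rewrite expr2 mx_VV.
split; last 1 first.
- by rewrite (exprD _ 2 2) VV /mx_S !bsimp4 -expr2 exp_s opp8.
all: rewrite /mx_C /mx_D /mx_Q /mx_V.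
- by rewrite !bsimp4 comm_cd hcd.
- by rewrite !bsimp4 comm_cq hcq.
- by rewrite !bsimp4 conj_dq.
- by rewrite !bsimp4 (diag_block_mxX (n := 4)) !bsimp4 hcs.
- by rewrite !bsimp4 comm_sd.
- by rewrite !bsimp4 (opp_block_mx (0 : 'M[R]_4)) !oppr0 opprK comm_sq.
- by rewrite (diag_block_mxX (n := 4)) exprAC exp_c // -signr_odd orho expr1 opp8 //.
- by rewrite (diag_block_mxX (n := 4)) exp_d // opp8.
- by rewrite expr2 !bsimp4 -expr2 exp_q opp8.
Qed.

End Blocks.

(** * Arithmetic of a and rho, and freeness of the words in C and D *)

Lemma setA_odd_gt2 a : setA a -> odd a /\ (2 < a)%N.
Proof.
case=> l [l0 hl ->].
have P u : u \in l -> odd (u.1 ^ u.2) /\ (2 < u.1 ^ u.2)%N.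
  move=> /hl[pu u1 u2]; have o1 : odd u.1.
    by move: (divn_eq u.1 4); rewrite u1 => ->; rewrite oddD oddM andbF.
  split; first by rewrite oddX o1 orbT.
  by rewrite (leq_trans (odd_prime_gt2 o1 pu)) // -{1}(expn1 u.1) leq_pexp2l // prime_gt0.
elim: l l0 P {hl} => // u [|v l] IH _ P.
  by rewrite big_seq1; apply: P; rewrite mem_head.
have [oR gR] := IH isT (fun w wl => P w (@mem_behead _ (u :: v :: l) w wl)).
have [oU gU] := P u (mem_head _ _).
by rewrite big_cons oddM oR oU (leq_trans gU) // leq_pmulr // (leq_trans _ gR).
Qed.

(** As rho is odd, rho ^ 2 + 1 is even, so its divisibility by the odd number a
extends to 2 * a.  And rho <> 1 because a does not divide 2. *)
Lemma root_choiceE rho a : root_choice rho -> setA a ->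
  [/\ odd (rho a), (rho a < a)%N, (2 * a %| rho a ^ 2 + 1)%N & (1 < rho a)%N].
Proof.
move=> h Aa; have [orho ltr hr] := h a Aa; have [oa a2] := setA_odd_gt2 Aa.
have a_dvd : (a %| rho a ^ 2 + 1)%N.
  move/eqP: hr; rewrite eqz_mod_dvd opprK => hr.
  by have := hr; rewrite -PoszD.
split=> //.
  by rewrite Gauss_dvd ?coprime2n // a_dvd dvdn2 oddD oddX orho.
case: (rho a) orho a_dvd => [|[|//]] // _.
by move/(dvdn_leq (isT : 0 < 2)%N); rewrite leqNgt a2.
Qed.

Section Freeness.
Variable R : realType.

Lemma diag_block_mx_fixed n (A B : 'M[R]_n) (x : 'cV[R]_(n + n)) :
  block_mx A 0 0 B *m x = x -> x != 0 ->
  (exists2 y : 'cV[R]_n, A *m y = y & y != 0) \/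
  (exists2 y : 'cV[R]_n, B *m y = y & y != 0).
Proof.
rewrite -(vsubmxK x); move: (usubmx x) (dsubmx x) => u d.
rewrite mul_block_col !mul0mx addr0 add0r => /eq_col_mx[hA hB] x0.
case: (eqVneq u 0) => [xu|xu]; last by left; exists u.
case: (eqVneq d 0) => [xd|xd]; last by right; exists d.
by rewrite xu xd col_mx0 eqxx in x0.
Qed.

(** Both rotations are powers of the rotation by pi / (a b), of order 2 a b; the
three conclusions are the divisibility of the total exponent by a, b and 2.
The factor e is 1 or -1 (in the form 2 b - 1), according to the sign of the
angle in the block of d. *)
Lemma rotation_pair_free a b e i j (v : 'cV[R]_2) :
  odd a -> odd b -> coprime a b -> odd e -> coprime b e ->
  (rotation (pi / a%:R) ^+ i * rotation (pi / b%:R) ^+ (e * j)) *m v = v ->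
  v != 0 -> [/\ (a %| i)%N, (b %| j)%N & ~~ odd (i + j)].
Proof.
move=> oa ob cab oe cbe.
have a0 : (0 < a)%N by case: a oa {cab}.
have b0 : (0 < b)%N by case: b ob {cab cbe}.
have aR : a%:R != 0 :> R by rewrite pnatr_eq0 -lt0n.
have bR : b%:R != 0 :> R by rewrite pnatr_eq0 -lt0n.
have -> : rotation (pi / a%:R : R) = rotation (pi / (a * b)%:R) ^+ b.
  rewrite rotationX -(mulr_natr (pi / _)) natrM; congr rotation.
  by field; rewrite aR bR.
have -> : rotation (pi / b%:R : R) = rotation (pi / (a * b)%:R) ^+ a.
  rewrite rotationX -(mulr_natr (pi / _)) natrM; congr rotation.
  by field; rewrite aR bR.
rewrite -!exprM -exprD => /rotation_fixed_dvd h /h{h}.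
rewrite muln_gt0 a0 b0 => /(_ isT); set n := (_ + _)%N => hn.
have an : (a %| n)%N by apply: dvdn_trans hn; rewrite mulnCA dvdn_mulr.
have bn : (b %| n)%N by apply: dvdn_trans hn; rewrite mulnA dvdn_mull.
have n2 : ~~ odd n by rewrite -dvdn2; apply: dvdn_trans hn; rewrite dvdn_mulr.
split.
- by move: an; rewrite (dvdn_addl _ (dvdn_mulr _ (dvdnn a))) Gauss_dvdr.
- move: bn; rewrite (dvdn_addr _ (dvdn_mulr _ (dvdnn b))) Gauss_dvdr.
    by rewrite Gauss_dvdr.
  by rewrite coprime_sym.
- by move: n2; rewrite !oddD !oddM oa ob oe.
Qed.

(** A nonzero vector has a nonzero component in one of the four planes.  In the
planes of the second half the exponent i is multiplied by rho, which is odd and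
prime to a and thus affects none of the three conclusions. *)
Lemma CD_free rho a b i j (x : 'cV[R]_8) :
  odd a -> odd b -> coprime a b -> odd (rho a) -> coprime a (rho a) ->
  (mx_C R rho a ^+ i * mx_D R b ^+ j) *m x = x -> x != 0 ->
  [/\ (a %| i)%N, (b %| j)%N & ~~ odd (i + j)].
Proof.
move=> oa ob cab or car.
have b0 : (0 < b)%N by case: b ob {cab}.
have bR : b%:R != 0 :> R by rewrite pnatr_eq0 -lt0n.
have half k (y : 'cV[R]_4) : (mx_c R a ^+ k * mx_d R b ^+ j) *m y = y -> y != 0 ->
    [/\ (a %| k)%N, (b %| j)%N & ~~ odd (k + j)].
  have rN : rotation (- pi / b%:R : R) ^+ j = rotation (pi / b%:R) ^+ ((2 * b).-1 * j).
    rewrite exprM; congr (_ ^+ j).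
    have : rotation (pi / b%:R : R) ^+ (2 * b) = 1.
      by rewrite mulnC exprM rotation_half // sqrrN expr1n.
    rewrite -[in X in X -> _](prednK (_ : 0 < 2 * b)%N) ?muln_gt0 // exprS => h.
    rewrite mulNr -[LHS]mulr1 -h mulrA rotationNK mul1r //.
  rewrite /mx_c /mx_d !(diag_block_mxX (n := 2)) (block_mxM (n := 2)).
  rewrite !mul0r !mulr0 !addr0 !add0r rN => hy y0.
  have o2b : odd (2 * b).-1 by case: (b) b0 => // n _; rewrite mulnS add2n /= oddM.
  have c2b : coprime b (2 * b).-1.
    have : coprime (2 * b).-1.+1 (2 * b).-1 by apply: coprimeSn.
    by rewrite prednK ?muln_gt0 // coprimeMl => /andP[].
  case: (diag_block_mx_fixed (n := 2) hy y0) => -[z hz z0].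
    exact: rotation_pair_free hz z0.
  by apply: (rotation_pair_free oa ob cab (e := 1)) z0 => //; rewrite ?coprimen1 // mul1n.
rewrite /mx_C /mx_D !(diag_block_mxX (n := 4)) (block_mxM (n := 4)).
rewrite !mul0r !mulr0 !addr0 !add0r => hx x0.
case: (diag_block_mx_fixed (n := 4) hx x0) => -[z hz z0].
  exact: half hz z0.
rewrite -exprM in hz; have [] := half _ _ hz z0.
by rewrite Gauss_dvdr // !oddD oddM or.
Qed.
End Freeness.

(** * Generated matrix groups and orthogonality *)

Section MatrixGroupFacts.
Variables (R : realType) (n : nat).
Implicit Types (S H : set 'M[R]_n) (g h : 'M[R]_n).

Lemma generated_min S H : matrix_group H -> S `<=` H -> generated S `<=` H.
Proof. by move=> mH SH g; apply. Qed.

Lemma sub_generated S : S `<=` generated S.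
Proof. by move=> g Sg H [_]; apply. Qed.

Lemma generated_group S H : matrix_group H -> S `<=` H -> matrix_group (generated S).
Proof.
move=> mH SH; split.
- by move=> g /(_ H (conj mH SH)); have [hGL _ _ _] := mH; apply: hGL.
- by move=> K [[_ K1 _ _] _].
- by move=> g h Sg Sh K hK; have [[_ _ KM _] _] := hK; apply: KM; [apply: Sg|apply: Sh].
- by move=> g Sg K hK; have [[_ _ _ KV] _] := hK; apply: KV; apply: Sg.
Qed.

Lemma mulmx1_invmx g h : g *m h = 1%:M -> invmx g = h.
Proof.
move=> gh; have [gu _] := mulmx1_unit gh.
by rewrite -[LHS]mulmx1 -gh mulmxA mulVmx // mul1mx.
Qed.

Lemma orthogonal_matrix_group : matrix_group (orthogonal_group R n).
Proof.
split.
- by move=> g /= /mulmx1_unit[].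
- by rewrite /orthogonal_group /= trmx1 mulmx1.
- move=> g h og oh; rewrite /orthogonal_group /= trmx_mul mulmxA -(mulmxA g) oh.
  by rewrite mulmx1.
- by move=> g og; rewrite /orthogonal_group /= (mulmx1_invmx og) trmxK; apply: mulmx1C.
Qed.

Lemma matrix_groupX H g k : matrix_group H -> H g -> H (g ^+ k).
Proof.
move=> [_ H1 HM _] Hg; elim: k => [|k IH]; first by rewrite expr0.
by rewrite exprS; apply: HM.
Qed.

End MatrixGroupFacts.

Section Orthogonality.
Variable R : realType.

Lemma orthogonal_diag_block n (A B : 'M[R]_n) :
  orthogonal_group R n A -> orthogonal_group R n B ->
  orthogonal_group R (n + n) (block_mx A 0 0 B).
Proof.
rewrite /orthogonal_group /= => hA hB.
rewrite tr_block_mx !trmx0 mulmx_block !mul0mx !mulmx0 hA hB !addr0 !add0r.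
by rewrite -scalar_mx_block.
Qed.

Lemma orthogonal_antidiag_block n (A B : 'M[R]_n) :
  orthogonal_group R n A -> orthogonal_group R n B ->
  orthogonal_group R (n + n) (block_mx 0 A B 0).
Proof.
rewrite /orthogonal_group /= => hA hB.
rewrite tr_block_mx !trmx0 mulmx_block !mul0mx !mulmx0 hA hB !addr0 !add0r.
by rewrite -scalar_mx_block.
Qed.

Lemma orthogonalN n (A : 'M[R]_n) :
  orthogonal_group R n A -> orthogonal_group R n (- A).
Proof. by rewrite /orthogonal_group /= linearN /= mulNmx mulmxN opprK. Qed.

Lemma orthogonal_rotation x : orthogonal_group R 2 (rotation x).
Proof. by rewrite /orthogonal_group /= rotation_tr -[LHS]rotationC rotationNK. Qed.

Lemma orthogonal_axial_symmetry : orthogonal_group R 2 (axial_symmetry R).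
Proof.
rewrite /orthogonal_group /= (_ : _^T = axial_symmetry R); first exact: axial_symmetry_sq.
apply/matrixP=> i j; rewrite !mxE.
by case: i j => [[|[|//]] ?] [[|[|//]] ?].
Qed.

Lemma orthogonal1 n : orthogonal_group R n 1%:M.
Proof. by case: (orthogonal_matrix_group R n). Qed.

Lemma orthogonal_q : orthogonal_group R 4 (mx_q R).
Proof.
rewrite mx_qE; apply: (orthogonal_antidiag_block (n := 2)); first exact: orthogonal1.
exact/orthogonalN/orthogonal1.
Qed.

Lemma orthogonal_s : orthogonal_group R 4 (mx_s R).
Proof.
rewrite mx_sE; apply: (orthogonal_antidiag_block (n := 2)).
  exact/orthogonalN/orthogonal_axial_symmetry.
exact/orthogonal_axial_symmetry.
Qed.

Lemma generators_orthogonal rho a b :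
  [set mx_C R rho a; mx_D R b; mx_Q R; mx_S R; mx_V R] `<=` orthogonal_group R 8.
Proof.
have oc : orthogonal_group R 4 (mx_c R a).
  by apply: (orthogonal_diag_block (n := 2)); apply: orthogonal_rotation.
have od : orthogonal_group R 4 (mx_d R b).
  by apply: (orthogonal_diag_block (n := 2)); apply: orthogonal_rotation.
have oq := orthogonal_q; have os := orthogonal_s.
move=> _ [[[[->|->]|->]|->]|->].
- apply: (orthogonal_diag_block (n := 4)) => //.
  exact: matrix_groupX (orthogonal_matrix_group R 4) oc.
- exact: (orthogonal_diag_block (n := 4)).
- by apply: (orthogonal_diag_block (n := 4)) => //; apply: orthogonalN.
- exact: (orthogonal_diag_block (n := 4)).
- by apply: (orthogonal_antidiag_block (n := 4)) => //; apply: orthogonal1.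
Qed.

Lemma Gab_group rho a b : matrix_group (Gab R rho a b).
Proof.
exact: generated_group (orthogonal_matrix_group R 8) (@generators_orthogonal rho a b).
Qed.

Lemma Gab_orthogonal rho a b : subgroup (Gab R rho a b) (orthogonal_group R 8).
Proof.
split; [exact: Gab_group|exact: orthogonal_matrix_group|].
exact: generated_min (orthogonal_matrix_group R 8) (@generators_orthogonal rho a b).
Qed.

Lemma Gab_C rho a b : Gab R rho a b (mx_C R rho a).
Proof. by apply: sub_generated; do 4!left. Qed.
Lemma Gab_D rho a b : Gab R rho a b (mx_D R b).
Proof. by apply: sub_generated; do 3!left; right. Qed.
Lemma Gab_Q rho a b : Gab R rho a b (mx_Q R).
Proof. by apply: sub_generated; do 2!left; right. Qed.
Lemma Gab_S rho a b : Gab R rho a b (mx_S R).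
Proof. by apply: sub_generated; left; right. Qed.
Lemma Gab_V rho a b : Gab R rho a b (mx_V R).
Proof. by apply: sub_generated; right. Qed.

(** Among the generators only D depends on b, so this yields the inclusions
between the groups. *)
Lemma mx_DX b t : (0 < b * t)%N -> mx_D R (b * t) ^+ t = mx_D R b.
Proof.
rewrite muln_gt0 => /andP[b0 t0].
have bR : b%:R != 0 :> R by rewrite pnatr_eq0 -lt0n.
have tR : t%:R != 0 :> R by rewrite pnatr_eq0 -lt0n.
have e (x : R) : x / (b * t)%:R *+ t = x / b%:R.
  by rewrite -(mulr_natr (x / _)) natrM; field; rewrite bR tR.
by rewrite /mx_D /mx_d (diag_block_mxX (n := 4)) (diag_block_mxX (n := 2)) !rotationX !e.
Qed.

Lemma Gab_sub rho a b b' : (0 < b')%N -> (b %| b')%N ->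
  subgroup (Gab R rho a b) (Gab R rho a b').
Proof.
move=> b'0 /dvdnP[t eb']; split; [exact: Gab_group|exact: Gab_group|].
apply: generated_min; first exact: Gab_group.
move=> _ [[[[->|->]|->]|->]|->].
- exact: Gab_C.
- have bt : b' = (b * t)%N by rewrite eb' mulnC.
  rewrite -(@mx_DX b t) -?bt //.
  exact: (matrix_groupX t (Gab_group rho a b') (@Gab_D rho a b')).
- exact: Gab_Q.
- exact: Gab_S.
- exact: Gab_V.
Qed.
End Orthogonality.

(** * The commutant of the group *)

Section Commutant.
Variable R : realType.

Lemma linear_cV_mulmx n (f : {linear 'cV[R]_n -> 'cV[R]_n}) :
  exists M : 'M[R]_n, forall x, f x = M *m x.
Proof.
exists (\matrix_(i, j) f (delta_mx j 0) i 0) => x.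
apply/matrixP=> i k; rewrite (ord1 k) {1}(matrix_sum_delta x) linear_sum summxE mxE.
apply: eq_bigr => j _; rewrite big_ord1 linearZ /= !mxE mulrC.
by congr (_ * _).
Qed.

Lemma mulmx_cV_inj n (A B : 'M[R]_n) :
  (forall x : 'cV[R]_n, A *m x = B *m x) -> A = B.
Proof.
move=> AB; apply/matrixP=> i j.
by have /matrixP/(_ i 0) := AB (delta_mx j 0); rewrite -!colE !mxE.
Qed.

(** The transpose is the inverse; it makes g + g^T available, which for a
rotation is a scalar. *)
Lemma comm_orthogonal_tr n (M g : 'M[R]_n) :
  orthogonal_group R n g -> M * g = g * M -> M * g^T = g^T * M.
Proof.
move=> og Mg; have og' : g^T * g = 1 by apply: mulmx1C.
have {}og : g * g^T = 1 by [].
by rewrite -[LHS]mul1r -og' -!mulrA (mulrA g M) -Mg -mulrA og mulr1.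
Qed.

Lemma comm_diag_block n (A B C D : 'M[R]_n) (t u : R) : t != u ->
  block_mx A B C D * block_mx t%:M 0 0 u%:M =
  block_mx t%:M 0 0 u%:M * block_mx A B C D :> 'M[R]_(n + n) ->
  B = 0 /\ C = 0.
Proof.
move=> tu; rewrite !block_mxM !mulr0 !mul0r !addr0 !add0r.
rewrite -![_ * _%:M]/(_ *m _%:M) -![_%:M * _]/(_%:M *m _).
rewrite !mul_scalar_mx !mul_mx_scalar => /eq_block_mx[_ /eqP hB /eqP hC _].
rewrite -subr_eq0 -scalerBl scaler_eq0 subr_eq0 eq_sym (negbTE tu) /= in hB.
rewrite -subr_eq0 -scalerBl scaler_eq0 subr_eq0 (negbTE tu) /= in hC.
by rewrite (eqP hB) (eqP hC).
Qed.

Lemma rotation_add_tr (x : R) : rotation x + (rotation x)^T = (2 * cos x)%:M.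
Proof.
rewrite rotation_tr; apply/matrixP=> i j; rewrite !mxE cosN sinN opprK.
by case: i j => [[|[|//]] ?] [[|[|//]] ?] /=; ring.
Qed.

Lemma comm_dihedral_scalar (x : R) (A : 'M[R]_2) : sin x != 0 ->
  A * rotation x = rotation x * A ->
  A * axial_symmetry R = axial_symmetry R * A -> exists t, A = t%:M.
Proof.
move=> sx hr hs; exists (A 0 0).
have s01 := congr1 (fun M : 'M[R]_2 => M 0 1) hs.
have s10 := congr1 (fun M : 'M[R]_2 => M 1 0) hs.
have r01 := congr1 (fun M : 'M[R]_2 => M 0 1) hr.
have l1 : lift ord0 ord0 = 1 :> 'I_2 by apply: val_inj.
rewrite !mxE !big_ord_recl !big_ord0 !mxE /= l1 in s01 s10 r01.
have A01 : A 0 1 = 0 by move: s01; lra.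
have A10 : A 1 0 = 0 by move: s10; lra.
have A11 : A 0 0 = A 1 1.
  apply: (mulfI sx); move: r01; rewrite A01; lra.
apply/matrixP=> i j; rewrite !mxE.
have z0 k : Ordinal (k : (0 < 2)%N) = 0 by apply: val_inj.
have z1 k : Ordinal (k : (1 < 2)%N) = 1 by apply: val_inj.
by case: i j => [[|[|//]] ?] [[|[|//]] ?]; rewrite ?z0 ?z1 ?A01 ?A10 ?A11.
Qed.

(** e := c d rotates the two planes by pi / a - pi / b and by pi / a + pi / b, so
e + e^T has two eigenvalues, whose difference is
4 sin (pi / a) sin (pi / b) > 0. *)
Lemma comm_cdqs_scalar a b (A : 'M[R]_4) : (1 < a)%N -> (1 < b)%N -> 
  A * mx_c R a = mx_c R a * A -> A * mx_d R b = mx_d R b * A ->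
  A * mx_q R = mx_q R * A -> A * mx_s R = mx_s R * A -> exists t, A = t%:M.
Proof.
move=> a1 b1 hc hd hq hs.
have sin0 n : (1 < n)%N -> 0 < sin (pi / n%:R : R).
  move=> n1; apply: sin_gt0_pi; rewrite divr_gt0 ?pi_gt0 ?ltr0n ?(ltnW n1) //=.
  by rewrite ltr_pdivrMr ?ltr0n ?(ltnW n1) // ltr_pMr ?pi_gt0 // ltr1n.
have sa := sin0 a a1; have sb := sin0 b b1.
pose e := mx_c R a * mx_d R b.
have oe : orthogonal_group R 4 e.
  have [_ _ oM _] := orthogonal_matrix_group R 4.
  by apply: oM; apply: (orthogonal_diag_block (n := 2)); apply: orthogonal_rotation.
have he : A * (e + e^T) = (e + e^T) * A.
  have h : A * e = e * A by rewrite /e mulrA hc -mulrA hd mulrA.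
  by rewrite mulrDr mulrDl h (comm_orthogonal_tr oe h).
have eE : e + e^T = (block_mx (2 * cos (pi / a%:R - pi / b%:R))%:M 0 0
                     (2 * cos (pi / a%:R + pi / b%:R))%:M : 'M[R]_(2 + 2)).
  rewrite /e /mx_c /mx_d (block_mxM (n := 2)) !mulr0 !mul0r !addr0 !add0r.
  rewrite -!rotationD mulNr (tr_block_mx (rotation _)) !trmx0.
  by rewrite (add_block_mx (rotation _)) !addr0 !rotation_add_tr.
move: hc hq hs he; rewrite {}eE {hd oe e}.
rewrite -(@submxK _ 2 2 2 2 A).
move: (ulsubmx _) (ursubmx _) (dlsubmx _) (drsubmx _) => A1 B B' A2 hc hq hs.
case/(comm_diag_block (n := 2)) => [|B0 B'0].
  rewrite -subr_eq0 cosB cosD.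
  rewrite (_ : _ - _ = (4 * (sin (pi / a%:R) * sin (pi / b%:R)))); last by ring.
  by rewrite !mulf_neq0 ?pnatr_eq0 // lt0r_neq0.
move: hc hq hs; rewrite {}B0 {}B'0 mx_qE mx_sE /mx_c !(block_mxM (n := 2)).
rewrite !(mulr0, mul0r, addr0, add0r, mulr1, mul1r, mulrN, mulNr).
move=> /(@eq_block_mx _ 2 2 2 2)[hr _ _ _] /(@eq_block_mx _ 2 2 2 2)[_ <- _ _].
case/(@eq_block_mx _ 2 2 2 2) => _ _ hs _.
have [t ->] := comm_dihedral_scalar (lt0r_neq0 sa) hr hs.
by exists t; rewrite -(@scalar_mx_block _ 2 2).
Qed.

(** C + C^T is twice cos (pi / a) on the first half and twice cos (pi rho / a) on
the second; cos is injective on the interval from 0 to pi, and 1 < rho < a. *)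
Lemma comm_CDQSV_scalar rho a b (M : 'M[R]_8) : (2 < a)%N -> (1 < b)%N ->
  (1 < rho a < a)%N ->
  M * mx_C R rho a = mx_C R rho a * M -> M * mx_D R b = mx_D R b * M ->
  M * mx_Q R = mx_Q R * M -> M * mx_S R = mx_S R * M ->
  M * mx_V R = mx_V R * M -> exists t, M = t%:M.
Proof.
move=> a2 b1 /andP[r1 ra] hC hD hQ hS hV.
have a0 : (0 < a)%N by apply: ltnW; apply: ltnW.
have hCt : M * (mx_C R rho a + (mx_C R rho a)^T) = (mx_C R rho a + (mx_C R rho a)^T) * M.
  have oC : orthogonal_group R 8 (mx_C R rho a).
    by apply: (@generators_orthogonal R rho a b); do 4!left.
  by rewrite mulrDr mulrDl hC (comm_orthogonal_tr oC hC).
have CE : mx_C R rho a + (mx_C R rho a)^T =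
    (block_mx (2 * cos (pi / a%:R))%:M 0 0
              (2 * cos (pi / a%:R *+ rho a))%:M : 'M[R]_(4 + 4)).
  have diag4 (x : R) : (block_mx (rotation x) 0 0 (rotation x) : 'M[R]_(2 + 2)) +
      (block_mx (rotation x) 0 0 (rotation x) : 'M[R]_(2 + 2))^T = (2 * cos x)%:M.
    rewrite (tr_block_mx (rotation _)) !trmx0 (add_block_mx (rotation _)) !addr0.
    by rewrite rotation_add_tr -(@scalar_mx_block _ 2 2).
  rewrite /mx_C /mx_c (diag_block_mxX (n := 2)) rotationX.
  by rewrite (@tr_block_mx _ 4 4 4 4) !trmx0 (@add_block_mx _ 4 4 4 4) !addr0 !diag4.
rewrite {}CE in hCt; move: hC hD hQ hS hV hCt; rewrite -(@submxK _ 4 4 4 4 M).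
move: (ulsubmx _) (ursubmx _) (dlsubmx _) (drsubmx _) => A B B' A' hC hD hQ hS hV.
case/(comm_diag_block (n := 4)) => [|B0 B'0].
  rewrite -subr_eq0 -mulrBr mulf_neq0 ?pnatr_eq0 // subr_eq0.
  have x0 : 0 < pi / a%:R :> R by rewrite divr_gt0 ?pi_gt0 ?ltr0n.
  have xr : pi / a%:R *+ rho a <= pi :> R.
    rewrite -(mulr_natr (pi / _)) mulrAC ler_pdivrMr ?ltr0n // ler_pM2l ?pi_gt0 //.
    by rewrite ler_nat ltnW.
  have x1 : pi / a%:R <= pi :> R.
    by rewrite ler_pdivrMr ?ltr0n // ler_pMr ?pi_gt0 // ler1n.
  apply/eqP => /cos_inj h.
  have /eqP : pi / a%:R = pi / a%:R *+ rho a :> R.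
    by apply: h; rewrite in_itv /= ?x1 ?xr andbT ?mulrn_wge0 // ltW.
  rewrite -{1}(mulr1n (pi / _)) => /eqP/(mulrIn (lt0r_neq0 x0)) e.
  by rewrite -e in r1.
move: hC hD hQ hS hV; rewrite {}B0 {}B'0 !(block_mxM (n := 4)).
rewrite !(mulr0, mul0r, addr0, add0r, mulr1, mul1r).
move=> /(@eq_block_mx _ 4 4 4 4)[hc _ _ _] /(@eq_block_mx _ 4 4 4 4)[hd _ _ _].
move=> /(@eq_block_mx _ 4 4 4 4)[hq _ _ _] /(@eq_block_mx _ 4 4 4 4)[hs _ _ _].
case/(@eq_block_mx _ 4 4 4 4) => _ hA _ _.
have [t tE] := comm_cdqs_scalar (ltnW a2) b1 hc hd hq hs.
by exists t; rewrite -hA tE -(@scalar_mx_block _ 4 4).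
Qed.

End Commutant.

(** * Fixed spaces and conjugacy classes *)

Section Involution.
Variable R : realType.

(** u exchanges the eigenspaces of h for 1 and -1, and the space is their direct
sum. *)
Lemma involution_Fix_dim n (h u : 'M[R]_n.*2) :
  h * h = 1 -> u \in unitmx -> u * h = - (h * u) ->
  has_dimension (Fix [set 1%:M; h]) n.
Proof.
move=> hh uu uh; pose W (e : R) := lker (linfun (mulmx (h - e%:M)) : 'End('cV[R]_n.*2)).
have memW e x : (x \in W e) = (h *m x == e *: x).
  by rewrite memv_ker lfunE /= mulmxBl mul_scalar_mx subr_eq0.
have hhx (x : 'cV[R]_n.*2) : h *m (h *m x) = x by rewrite mulmxA [h *m h]hh mul1mx.
have uhx (x : 'cV[R]_n.*2) : h *m (u *m x) = - (u *m (h *m x)).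
  by rewrite !mulmxA [u *m h]uh mulNmx opprK.
have le e : (\dim (W e) <= \dim (W (- e)))%N.
  pose f := linfun (mulmx u) : 'End('cV[R]_n.*2).
  have -> : \dim (W e) = \dim (f @: W e).
    apply/esym/limg_dim_eq; apply/eqP; rewrite -subv0; apply/subvP => x.
    rewrite memv_cap memv_ker lfunE /= memv0 => /andP[_ /eqP ux].
    by rewrite -(mulKmx uu x) ux mulmx0.
  apply/dimvS/subvP => _ /memv_imgP[x + ->].
  rewrite !memW lfunE /= uhx => /eqP ->.
  by rewrite -scalemxAr scaleNr.
have eqd : \dim (W 1) = \dim (W (- 1)).
  by apply/eqP; rewrite eqn_leq le -{2}(opprK 1) le.
have cap : (W 1 :&: W (- 1) = 0)%VS.
  apply/eqP; rewrite -subv0; apply/subvP => x.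
  rewrite memv_cap !memW memv0 => /andP[/eqP -> /eqP/esym].
  rewrite scale1r scaleN1r => /eqP; rewrite -subr_eq0 -opprD oppr_eq0.
  by rewrite -mulr2n -scaler_nat scaler_eq0 pnatr_eq0.
have full : (W 1 + W (- 1) = fullv)%VS.
  apply/eqP; rewrite eqEsubv subvf /=; apply/subvP => x _.
  apply/memv_addP; exists (2^-1 *: (x + h *m x)).
    by rewrite memW scale1r -scalemxAr mulmxDr hhx addrC.
  exists (2^-1 *: (x - h *m x)).
    by rewrite memW scaleN1r -scalemxAr mulmxBr hhx -scalerN opprB.
  rewrite -scalerDr addrACA subrr addr0 -mulr2n -(scaler_nat 2 x) scalerA.
  by rewrite mulVf ?scale1r.
exists (W 1).
  apply/seteqP; split=> x /=.
    by move=> hx; rewrite memW scale1r hx //; right.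
  by rewrite memW scale1r => /eqP hx k [->|->] //; rewrite mul1mx.
have := dimv_disjoint_sum cap; rewrite full dimvf -eqd addnn.
by rewrite [dim _]muln1 => /double_inj.
Qed.

End Involution.

Lemma card_range_finType (T : finType) U (f : T -> U) :
  injective f -> (range f #= `I_#|T|)%card.
Proof.
move=> fI; have gI : injective (f \o enum_val : 'I_#|T| -> U).
  exact: inj_comp fI enum_val_inj.
have -> : range f = range (f \o enum_val : 'I_#|T| -> U).
  apply/seteqP; split=> _ [x _ <-]; last by exists (enum_val x).
  by exists (enum_rank x) => //=; rewrite enum_rankK.
apply: card_eq_trans (inj_card_eq (in2W gI)) _.
by rewrite card_eq_sym; apply: card_II.
Qed.

Section Conjugation.
Variables (R : realType) (n : nat).
Implicit Types (H K : set 'M[R]_n) (g h : 'M[R]_n).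

Lemma conjugate1 H : conjugate H 1%:M = H.
Proof.
apply/seteqP; split=> [_ [h Hh <-]|h Hh]; first by rewrite invmx1 mulmx1 mul1mx.
by exists h => //; rewrite invmx1 mulmx1 mul1mx.
Qed.

Lemma conjugateM H g h : g \in unitmx -> h \in unitmx ->
  conjugate (conjugate H g) h = conjugate H (h *m g).
Proof.
move=> gu hu.
have e k : h *m (g *m k *m invmx g) *m invmx h = h *m g *m k *m invmx (h *m g).
  rewrite (_ : invmx (h *m g) = invmx g *m invmx h); first by rewrite !mulmxA.
  apply: mulmx1_invmx.
  by rewrite mulmxA -(mulmxA h) mulmxV // mulmx1 mulmxV.
apply/seteqP; split=> [_ [_ [k Hk <-] <-]|_ [k Hk <-]]; first by exists k.
by exists (g *m k *m invmx g) => //; exists k.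
Qed.

Lemma conjugate_pair g h : g \in unitmx ->
  conjugate [set 1%:M; h] g = [set 1%:M; g *m h *m invmx g].
Proof.
move=> gu; have e : g *m 1%:M *m invmx g = 1%:M by rewrite mulmx1 mulmxV.
apply/seteqP; split=> [_ [k [->|->] <-]|_ [->|->]].
- by left.
- by right.
- by exists 1%:M => //; left.
- by exists h => //; right.
Qed.

Lemma mem_conjugacy_class K H : matrix_group K -> conjugacy_class K H H.
Proof. by case=> _ K1 _ _; exists 1%:M => //; apply: conjugate1. Qed.

Lemma conjugacy_class_conjugate K H g : matrix_group K -> K g ->
  conjugacy_class K (conjugate H g) = conjugacy_class K H.
Proof.
move=> [KU _ KM KV] Kg; have gu := KU g Kg.
apply/seteqP; split=> [_ [k Kk <-]|_ [k Kk <-]].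
  by exists (k *m g); [apply: KM|rewrite conjugateM //; apply: KU].
exists (k *m invmx g); first by apply: KM => //; apply: KV.
rewrite conjugateM ?mulmxKV //.
by apply: KU; apply: KM => //; apply: KV.
Qed.

End Conjugation.

(** * The groups G_(a,b) *)

Section Gab.
Variables (R : realType) (rho : nat -> nat) (a b : nat).
Hypotheses (hrho : root_choice rho) (Aa : setA a) (b3 : (3 <= b)%N).
Hypotheses (ob : odd b) (cab : coprime a b).

Local Notation C := (mx_C R rho a).
Local Notation D := (mx_D R b).
Local Notation Q := (mx_Q R).
Local Notation V := (mx_V R).
Local Notation G := (Gab R rho a b).
Local Notation E := (word C D Q V).
Local Notation P := (reflection Q V).

Let oa : odd a. Proof. by case: (setA_odd_gt2 Aa). Qed.
Let a2 : (2 < a)%N. Proof. by case: (setA_odd_gt2 Aa). Qed.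
Let a0 : (0 < a)%N. Proof. exact: leq_trans a2. Qed.
Let b0 : (0 < b)%N. Proof. exact: leq_trans b3. Qed.
Let hr : (2 * a %| rho a ^ 2 + 1)%N.
Proof. by case: (root_choiceE hrho Aa). Qed.
Let orho : odd (rho a). Proof. by case: (root_choiceE hrho Aa). Qed.
Let rel : relations a b (rho a) C D Q V.
Proof. exact: CDQV_relations. Qed.
Let coprime_rho : coprime a (rho a).
Proof.
have ha : (a %| rho a ^ 2 + 1)%N by apply: dvdn_trans hr; apply: dvdn_mull.
rewrite /coprime -dvdn1 -(@dvdn_addr (rho a ^ 2)).
  by apply: dvdn_trans ha; apply: dvdn_gcdl.
by rewrite expnS dvdn_mulr // dvdn_gcdr.
Qed.

Lemma fixed_CD (x : 'cV[R]_8) i j : x != 0 -> (C ^+ i * D ^+ j) *m x = x ->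
  [/\ (a %| i)%N, (b %| j)%N & ~~ odd (i + j)].
Proof. by move=> x0 fx; apply: CD_free oa ob cab orho coprime_rho fx x0. Qed.

Lemma fixedM (x : 'cV[R]_8) (g h : 'M[R]_8) : g *m x = x -> h *m x = x -> (g * h) *m x = x.
Proof. by move=> gx hx; rewrite -[g * h]/(g *m h) -mulmxA hx. Qed.

Lemma CD_eq1 i j : C ^+ i * D ^+ j = 1 ->
  [/\ (a %| i)%N, (b %| j)%N & ~~ odd (i + j)].
Proof.
move=> e; apply: (@fixed_CD (const_mx 1)); last by rewrite e mul1mx.
by apply/eqP => /matrixP/(_ 0 0); rewrite !mxE; apply/eqP/oner_neq0.
Qed.

Lemma GabE : G = [set g | exists p, g = E p.1.1 p.1.2 p.2.1 p.2.2].
Proof.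
apply/seteqP; split.
  apply: generated_min; first split.
  - move=> _ [[[i j] [k l]] ->]; have [p e] := word_inv oa ob rel i j k l.
    by have [] := mulmx1_unit e.
  - by exists ((0, 0), (0, 0)); rewrite /word !expr0 !mulr1.
  - move=> _ _ [p ->] [q ->].
    have [u e] := wordsM ob rel p.1.1 p.1.2 p.2.1 p.2.2 q.1.1 q.1.2 q.2.1 q.2.2.
    by exists (u, (p.2.1 + q.2.1, p.2.2 + q.2.2))%N; rewrite -e.
  - move=> _ [p ->]; have [q e] := word_inv oa ob rel p.1.1 p.1.2 p.2.1 p.2.2.
    by rewrite (mulmx1_invmx e); exists (q, (3 * p.2.1, 7 * p.2.2))%N.
  move=> _ [[[[->|->]|->]|->]|->].
  - by exists ((1, 0), (0, 0)); rewrite /word !expr0 !mulr1.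
  - by exists ((0, 1), (0, 0)); rewrite /word !expr0 !mulr1 mul1r.
  - by exists ((0, 0), (1, 0)); rewrite /word !expr0 !mulr1 !mul1r.
  - by exists ((0, 0), (0, 2)); rewrite /word !expr0 !mulr1 !mul1r expr2 mx_VV.
  - by exists ((0, 0), (0, 1)); rewrite /word !expr0 !mulr1 !mul1r.
move=> _ [p ->]; have gG := Gab_group R rho a b; have [_ _ GM _] := gG.
have GX g k (Gg : G g) : G (g ^+ k) := matrix_groupX k gG Gg.
apply: (GM); last exact: (GX _ _ (@Gab_V R rho a b)).
apply: (GM); last exact: (GX _ _ (@Gab_Q R rho a b)).
by apply: (GM); [exact: (GX _ _ (@Gab_C R rho a b))|exact: (GX _ _ (@Gab_D R rho a b))].
Qed.

(** By word_inj the words in the box are distinct.  A word outside of it is moved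
inside by word_mod and by D ^+ b = -1 = C ^+ a, which trades b of the exponent
j for a of the exponent i. *)
Lemma Gab_card : (G #= `I_(16 * (a * b)))%card.
Proof.
pose f (p : 'I_(2 * a) * 'I_b * ('I_2 * 'I_4)) : 'M[R]_8 := E p.1.1 p.1.2 p.2.1 p.2.2.
have fI : injective f.
  move=> [[i j] [k l]] [[i' j'] [k' l']].
  case/(word_inj oa ob hr rel (ltnW a2) CD_eq1) => //= *.
  by congr (_, _, (_, _)); apply: val_inj.
have -> : (16 * (a * b) = #|{: 'I_(2 * a) * 'I_b * ('I_2 * 'I_4)}|)%N.
  by rewrite !card_prod !card_ord -(mulnA 2) mulnAC.
rewrite (_ : G = range f); first exact: card_range_finType.
rewrite GabE; apply/seteqP; split=> [_ [p ->]|_ [p _ <-]]; last by eexists (_, _, (_, _)).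
rewrite (word_mod rel).
set i := (_ + _)%N; set j := p.1.2; set k := (_ %% 2)%N; set l := (_ %% 4)%N.
have lk : (k < 2)%N by rewrite ltn_pmod.
have ll : (l < 4)%N by rewrite ltn_pmod.
pose i' := ((i + a * (j %/ b)) %% (2 * a))%N; pose j' := (j %% b)%N.
have li' : (i' < 2 * a)%N by rewrite ltn_pmod // muln_gt0 a0.
have lj' : (j' < b)%N by rewrite ltn_pmod.
exists (Ordinal li', Ordinal lj', (Ordinal lk, Ordinal ll)) => //.
rewrite /f /word /=; congr (_ * _ * _).
rewrite [in RHS](divn_eq j b) exprD mulnC exprM (exp_D rel) mulrA; congr (_ * _).
rewrite -(exp_C rel) -exprM -exprD (divn_eq (i + _) (2 * a)) exprD.
by rewrite (exp_Cdvd rel (dvdn_mull _ (dvdnn _))) mul1r.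
Qed.

Lemma Gab_absolutely_irreducible : absolutely_irreducible G.
Proof.
move=> f fG; have [M fM] := linear_cV_mulmx f.
have comm g : G g -> M * g = g * M.
  move=> Gg; apply: mulmx_cV_inj => x.
  by rewrite -![_ * _]/(_ *m _) -!mulmxA -!fM fG.
have [t Mt] : exists t, M = t%:M.
  have [_ rho_lt _ rho1] := root_choiceE hrho Aa.
  apply: (@comm_CDQSV_scalar R rho a b); rewrite ?rho1 ?(ltnW b3) //; apply: comm.
  - exact: Gab_C.
  - exact: Gab_D.
  - exact: Gab_Q.
  - exact: Gab_S.
  - exact: Gab_V.
by exists t => x; rewrite fM Mt mul_scalar_mx.
Qed.

Let mG : matrix_group G. Proof. exact: Gab_group. Qed.

Lemma Gab_word i j k l : G (E i j k l).
Proof. by rewrite GabE; exists ((i, j), (k, l)). Qed.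

Let PE : P = E 0 0 1 2. Proof. by rewrite word_refl !mul1r. Qed.

Lemma isotropy_cases x : x != 0 -> isotropy G x = [set 1%:M] \/
  exists i j, isotropy G x = [set 1%:M; E i j 1 2].
Proof.
move=> x0; have M := @fixedM x; have F i j := @fixed_CD x i j x0.
have G1 : isotropy G x 1%:M by split; [case: mG|rewrite mul1mx].
have cases g : isotropy G x g -> g = 1%:M \/ exists i j, g = E i j 1 2.
  case; rewrite GabE => -[p ->] gx.
  case: (fixing_word_cases oa ob hr rel M F gx) => [->|[i ->]]; first by left.
  by right; exists i, p.1.2.
have [[i [j hx]]|nx] := pselect (exists i j, E i j 1 2 *m x = x).
  right; exists i, j; apply/seteqP; split=> [g Ig|_ [->|->]] //; last first.
    by split=> //; apply: Gab_word.
  case: (cases g Ig) => [->|[i' [j' ge]]]; first by left.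
  right; rewrite ge; apply: (fixing_refl_uniq oa ob hr rel M F) => //.
  by rewrite -ge; case: Ig.
left; apply/seteqP; split=> [g Ig|_ ->] //.
case: (cases g Ig) => [->|[i [j ge]]] //.
by case: nx; exists i, j; rewrite -ge; case: Ig.
Qed.

Lemma refl_neq1 : P <> 1.
Proof.
rewrite PE => /(word_eq1 oa ob hr rel (ltnW a2) CD_eq1).
by case.
Qed.

Lemma refl_neqN1 : P <> -1.
Proof.
move=> PN1; have : E a 0 1 2 = 1.
  by rewrite -[a]add0n -(opp_word rel) -PE PN1 opprK.
by move=> /(word_eq1 oa ob hr rel (ltnW a2) CD_eq1) [].
Qed.

Lemma N1_neq1 : (-1 : 'M[R]_8) <> 1.
Proof.
move=> e; have /CD_eq1[_ _] : C ^+ a * D ^+ 0 = 1 by rewrite mulr1 (exp_C rel).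
by rewrite addn0 oa.
Qed.

(** V anticommutes with the reflection P, hence its conjugate by g with that of
P. *)
Lemma refl_class_Fix K : conjugacy_class G [set 1%:M; P] K -> has_dimension (Fix K) 4.
Proof.
case=> g Gg <-; have [GU _ _ _] := mG; have gu : g \in unitmx := GU g Gg.
rewrite conjugate_pair //.
have gK : g^-1 * g = 1 by apply: mulVmx.
have Vu : V \in unitmx by apply: GU; apply: Gab_V.
move: P (refl_sq rel) (anti_V_refl rel) => p pp vp.
move: (V : 'M[R]_8) Vu vp => v vu vp.
rewrite -![_ *m _]/(_ * _) -[invmx g]/(g^-1).
apply: (@involution_Fix_dim R 4 _ (g * v * g^-1)).
- by rewrite -!mulrA (mulrA g^-1 g) gK mul1r (mulrA p p) pp mul1r; apply: mulmxV.
- by rewrite unitmx_mul unitmx_mul gu unitmx_inv gu vu.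
- by rewrite -!mulrA !(mulrA g^-1 g) !gK !mul1r (mulrA v p) vp mulNr mulrN !mulrA.
Qed.

(** The type of the isotropy group of P is attained since Fix P is nonzero. *)
Lemma refl_isotropy : exists2 x : 'cV[R]_8, x != 0 & isotropy G x = [set 1%:M; P].
Proof.
have [W FW dW] := refl_class_Fix (mem_conjugacy_class [set 1%:M; P] mG).
have x0 : vpick W != 0 by rewrite vpick0 -dimv_eq0 dW.
exists (vpick W) => //.
have Px : P *m vpick W = vpick W.
  have : Fix [set 1%:M; P] (vpick W) by rewrite FW /= memv_pick.
  by apply; right.
have IP : isotropy G (vpick W) P by split=> //; rewrite PE; apply: Gab_word.
case: (isotropy_cases x0) => [e|[i [j e]]]; rewrite e in IP *.
  by case: refl_neq1.
by case: IP => [/refl_neq1//|<-].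
Qed.

(** The isotropy groups are G at 0, the trivial group, and groups of order 2
generated by a reflection; the last ones form one class by refl_conj.  They are
not G, which contains -1 besides 1, and the reflection is not -1. *)
Lemma Gab_isotropy_types :
  nontrivial_isotropy_types G = [set conjugacy_class G [set 1%:M; P]].
Proof.
have [GU G1 GM GV] := mG.
apply/seteqP; split=> [_ [[x _ <-] nt]|_ ->].
  have [n1 nG] := nt _ (mem_conjugacy_class (isotropy G x) mG).
  have [x0|x0] := eqVneq x 0.
    by case: nG; apply/seteqP; split=> [g []//|g Gg]; split=> //; rewrite x0 mulmx0.
  have [//|[i [j ->]]] := isotropy_cases x0.
  have [p [q [e hE]]] := refl_conj oa ob hr rel i j.
  have Gg := Gab_word p q 0 e; have gu := GU _ Gg.
  rewrite /= -[in RHS](conjugacy_class_conjugate _ mG Gg) conjugate_pair //.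
  congr (conjugacy_class _ [set _; _]).
  by rewrite -[E p q 0 e *m _]hE mulmxK.
split.
  by have [x _ e] := refl_isotropy; exists x => //; rewrite e.
move=> _ [g Gg <-]; have gu := GU g Gg; rewrite conjugate_pair //.
have inj (t : R) : g *m P *m invmx g = t%:M -> P = t%:M.
  move=> e; rewrite -(mulKmx gu P) -(mulmxKV gu (g *m P)) e.
  by rewrite -scalar_mxC mulmxA mulVmx // mul1mx.
split=> eK.
  have : [set 1%:M] (g *m P *m invmx g) by rewrite -eK; right.
  by move/inj/refl_neq1.
have : G (-1) by rewrite -(exp_C rel); apply: matrix_groupX mG (@Gab_C _ _ _ _).
rewrite -eK => -[/N1_neq1//|/esym e].
apply: refl_neqN1; rewrite -[RHS](raddfN (@scalar_mx R 8) 1).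
by apply: inj; rewrite e raddfN.
Qed.

End Gab.

Theorem theorem1p5 (R : realType) (rho : nat -> nat) (hrho : root_choice rho) :
  (forall a b : nat, setA a -> (3 <= b)%N -> odd b -> coprime a b ->
     subgroup (Gab R rho a b) (orthogonal_group R 8) /\
     (Gab R rho a b #= `I_(16 * (a * b)))%card) /\
  (forall a b b' : nat, setA a -> (3 <= b)%N -> odd b -> coprime a b ->
     (b < b')%N -> odd b' -> coprime a b' -> (b %| b')%N ->
     subgroup (Gab R rho a b) (Gab R rho a b')) /\
  (forall a b : nat, setA a -> (3 <= b)%N -> odd b -> coprime a b ->
     absolutely_irreducible (Gab R rho a b) /\
     exists T : set (set 'M[R]_8),
       nontrivial_isotropy_types (Gab R rho a b) = [set T] /\
       forall K : set 'M[R]_8, T K -> has_dimension (Fix K) 4).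
Proof.
split=> [a b Aa b3 ob cab|]; last split=> [a b b' _ _ _ _ bb' _ _|a b Aa b3 ob cab].
- by split; [apply: Gab_orthogonal|apply: Gab_card].
- by apply: Gab_sub; apply: leq_ltn_trans bb'.
- split; first exact: Gab_absolutely_irreducible.
  exists (conjugacy_class (Gab R rho a b) [set 1%:M; reflection (mx_Q R) (mx_V R)]).
  by split=> [|K]; [apply: Gab_isotropy_types|apply: refl_class_Fix].
Qed.
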